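(* Paths, cycles, trees, fans, the hexagonal grid and the octagonal-square grid are total-threshold-colorable. The triangular grid and the triangle-square grid are not total-threshold-colorable.
   Context: All graphs are finite and simple. An edge-labeling of $G=(V,E)$ is a map $\ell:E\to\{N,F\}$, partitioning $E$ into near edges $N$ and far edges $F$. For integers $r\ge1$, $t\ge0$, an $(r,t)$-threshold-coloring of $G$ with respect to $\ell$ is a map $c:V\to\{1,\dots,r\}$ such that for every edge $uv\in E$: $uv\in N$ iff $|c(u)-c(v)|\le t$. A graph $G$ is total-threshold-colorable if for every edge-labeling $\ell$ of $G$ there exist integers $r\ge1,t\ge0$ (possibly depending on $\ell$) and an $(r,t)$-threshold-coloring of $G$ with respect to $\ell$. A fan is a graph obtained from a path $P$ by adding a new vertex adjacent to all vertices of $P$. The hexagonal grid, triangular grid, octagonal-square grid and triangle-square grid are the (finite portions of the) graphs of the planar tilings by regular hexagons (internal vertices of degree 3), by equilateral triangles (internal vertices of degree 6), by regular octagons and squares (the 4.8.8 tiling), and by squares and equilateral triangles (the ''4-3 grid''), respectively; positive statements refer to every such grid graph, negative ones to the existence of such a grid graph which is not total-threshold-colorable. *)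

(* Defs.v *)
From HB Require Import structures.
From mathcomp Require Import all_boot all_order all_algebra.
Set Implicit Arguments. Unset Strict Implicit. Unset Printing Implicit Defensive.
Import Order.TTheory GRing.Theory Num.Theory.

Record sgraph := SGraph {
  vertex :> finType;
  adj : rel vertex;
  adj_sym : symmetric adj;
  adj_irr : irreflexive adj }.

Definition edges (G : sgraph) : {set {set G}} :=
  [set e | [exists u, exists v, adj u v && (e == [set u; v])]].

(* An edge-labeling is given by its set N of near edges, N \subset edges G;
   the far edges are edges G :\: N. *)
Definition threshold_coloring (r t : nat) (G : sgraph) (N : {set {set G}})
    (c : G -> nat) : Prop :=
  (forall v : G, 1 <= c v <= r) /\
  (forall u v : G, adj u v ->
     ([set u; v] \in N) = (`|(c u)%:Z - (c v)%:Z| <= t%:Z)%R).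

Definition total_threshold_colorable (G : sgraph) : Prop :=
  forall N : {set {set G}}, N \subset edges G ->
  exists r t : nat, 1 <= r /\ exists c : G -> nat, threshold_coloring r t N c.

Definition graph_iso (G H : sgraph) : Prop :=
  exists f : G -> H, bijective f /\ forall u v : G, adj u v = adj (f u) (f v).

Definition path_rel (n : nat) : rel 'I_n :=
  [rel i j : 'I_n | (i.+1 == j :> nat) || (j.+1 == i :> nat)].

Fact path_rel_sym n : symmetric (@path_rel n).
Proof. by move=> i j; rewrite /path_rel /= orbC. Qed.

Fact path_rel_irr n : irreflexive (@path_rel n).
Proof. by move=> i; rewrite /path_rel /= orbb gtn_eqF. Qed.

Definition path_graph (n : nat) : sgraph :=
  SGraph (@path_rel_sym n) (@path_rel_irr n).

(* For n >= 3 the conjunct i != j is redundant; it only makes the relation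
   irreflexive for n = 1. *)
Definition cycle_rel (n : nat) : rel 'I_n :=
  [rel i j : 'I_n | (i != j) &&
     ((i.+1 %% n == j :> nat) || (j.+1 %% n == i :> nat))].

Fact cycle_rel_sym n : symmetric (@cycle_rel n).
Proof. by move=> i j; rewrite /cycle_rel /= eq_sym orbC. Qed.

Fact cycle_rel_irr n : irreflexive (@cycle_rel n).
Proof. by move=> i; rewrite /cycle_rel /= eqxx. Qed.

Definition cycle_graph (n : nat) : sgraph :=
  SGraph (@cycle_rel_sym n) (@cycle_rel_irr n).

(* The vertex None is joined to all vertices of G. *)
Definition cone_rel (G : sgraph) : rel (option G) := fun x y =>
  match x, y with
  | Some u, Some v => adj u v
  | None, None => false
  | _, _ => true
  end.

Fact cone_rel_sym G : symmetric (@cone_rel G).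
Proof. by move=> [u|] [v|] //=; rewrite adj_sym. Qed.

Fact cone_rel_irr G : irreflexive (@cone_rel G).
Proof. by move=> [u|] //=; rewrite adj_irr. Qed.

Definition cone (G : sgraph) : sgraph :=
  SGraph (@cone_rel_sym G) (@cone_rel_irr G).

Definition is_path (G : sgraph) : Prop :=
  exists2 n, 1 <= n & graph_iso G (path_graph n).

Definition is_cycle (G : sgraph) : Prop :=
  exists2 n, 3 <= n & graph_iso G (cycle_graph n).

Definition is_fan (G : sgraph) : Prop :=
  exists2 n, 1 <= n & graph_iso G (cone (path_graph n)).

Definition is_tree (G : sgraph) : Prop :=
  [/\ 0 < #|G|,
      forall u v : G, connect (@adj G) u v
    & forall s : seq G, 3 <= size s -> ~~ ucycleb (@adj G) s].

(* A doubly periodic infinite graph with k vertices per translation cell: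
   the vertex (i, (x, y)) is the i-th vertex p_i of the cell translated by
   x a1 + y a2.  Each (i, j, (dx, dy)) in E joins (i, (x, y)) to
   (j, (x + dx, y + dy)) for all integers x and y. *)
Definition lattice_vertex (k : nat) : Type := ('I_k * (int * int))%type.

Definition lattice_adj (k : nat) (E : seq (nat * nat * (int * int))) :
    rel (lattice_vertex k) := fun p q =>
  ((p.1 : nat, q.1 : nat, (q.2 - p.2)%R) \in E) ||
  ((q.1 : nat, p.1 : nat, (p.2 - q.2)%R) \in E).

(* In each tiling below the tiles have unit sides, and the edges are exactly
   the pairs of tiling vertices at distance 1 in the indicated embedding. *)

(* a1 = (1, 0), a2 = (1/2, sqrt 3 / 2); p_0 = (0, 0). *)
Definition triangular_lattice : rel (lattice_vertex 1) :=
  lattice_adj [:: (0, 0, (1, 0)%R); (0, 0, (0, 1)%R); (0, 0, (1, -1)%R)].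

(* a1 = (sqrt 3 / 2, 3/2), a2 = (- sqrt 3 / 2, 3/2);
   p_0 = (0, 0), p_1 = (0, 1). *)
Definition hexagonal_lattice : rel (lattice_vertex 2) :=
  lattice_adj [:: (0, 1, (0, 0)%R); (0, 1, (-1, 0)%R); (0, 1, (0, -1)%R)].

(* The tiling 4.8.8.  a1 = (1 + sqrt 2, 0), a2 = (0, 1 + sqrt 2);
   p_0, p_1, p_2, p_3 = (s, 0), (0, s), (-s, 0), (0, -s), s = sqrt 2 / 2. *)
Definition octagonal_square_lattice : rel (lattice_vertex 4) :=
  lattice_adj [:: (0, 1, (0, 0)%R); (1, 2, (0, 0)%R); (2, 3, (0, 0)%R);
                  (3, 0, (0, 0)%R); (0, 2, (1, 0)%R); (1, 3, (0, 1)%R)].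

(* There are two uniform tilings by squares and equilateral triangles. *)

(* The elongated triangular tiling 3.3.3.4.4, rows of squares alternating with
   rows of triangles.  a1 = (1, 0), a2 = (1/2, 1 + sqrt 3 / 2);
   p_0 = (0, 0), p_1 = (0, 1). *)
Definition elongated_triangular_lattice : rel (lattice_vertex 2) :=
  lattice_adj [:: (0, 0, (1, 0)%R); (1, 1, (1, 0)%R); (0, 1, (0, 0)%R);
                  (1, 0, (0, 1)%R); (1, 0, (-1, 1)%R)].

(* The snub square tiling 3.3.4.3.4.  a1 = (b, 0), a2 = (0, b) with
   b = sqrt (2 + sqrt 3); p_0 p_1 p_2 p_3 is the unit square with p_0 = (0, 0),
   p_1 = (cos 15, sin 15), p_3 = (- sin 15, cos 15), angles in degrees. *)
Definition snub_square_lattice : rel (lattice_vertex 4) :=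
  lattice_adj [:: (0, 1, (0, 0)%R); (1, 2, (0, 0)%R); (2, 3, (0, 0)%R);
                  (3, 0, (0, 0)%R); (0, 1, (-1, 0)%R); (2, 3, (1, 0)%R);
                  (1, 2, (0, -1)%R); (0, 3, (0, -1)%R); (0, 2, (0, -1)%R);
                  (1, 3, (1, 0)%R)].

(* G is, up to isomorphism, a finite portion of the infinite graph e: a finite
   subgraph, resp. the subgraph induced by a finite set of vertices. *)
Definition subgraph_of (T : Type) (e : rel T) (G : sgraph) : Prop :=
  exists f : G -> T, injective f /\ forall u v : G, adj u v -> e (f u) (f v).

Definition induced_subgraph_of (T : Type) (e : rel T) (G : sgraph) : Prop :=
  exists f : G -> T, injective f /\ forall u v : G, adj u v = e (f u) (f v).

(* Main.v *)
Require Import Defs.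
From mathcomp Require Import all_boot all_order all_algebra.
From mathcomp Require Import zify.
Set Implicit Arguments. Unset Strict Implicit. Unset Printing Implicit Defensive.
Import Order.TTheory GRing.Theory Num.Theory.

(** For the positive part, take r = 5 and t = 1.  Choose an independent set C
    ("centers") such that every other vertex has at most one neighbor in C and
    deleting C leaves a forest.  Color the centers 3 and every other vertex
    3 + 1 or 3 - 1 if the edge to its center is near, 3 + 2 or 3 - 2 if it is
    far.  Whatever these magnitudes are, two non-central vertices get near
    colors iff their signs agree, and on a forest the signs can be prescribed to
    agree exactly along the near edges.  Trees need no center, cycles one, fans
    have their apex as center, and both grids have a perfect code (one vertex of
    each square for the tiling 4.8.8) whose removal leaves disjoint paths.

    For the negative part, a small labeled patch of each grid is infeasible:
    however the far edges are oriented by increasing color, the color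
    differences contradict each other along some cycle. *)

(** * Sign assignments on forests *)

Definition balanced_on (T : finType) (e lab : rel T) (A : {set T}) : Prop :=
  exists s : T -> bool,
    {in A &, forall u v, e u v -> s u (+) s v = lab u v}.

Section Balance.
Variables (T : finType) (e lab : rel T).
Hypotheses (e_sym : symmetric e) (e_irr : irreflexive e).
Hypothesis lab_sym : symmetric lab.

Lemma balanced_on_set0 : balanced_on e lab set0.
Proof. by exists xpredT => u v; rewrite inE. Qed.

(** At most one neighbor in [A] constrains the sign of [v]; with none, any sign will do. *)
Lemma balanced_on_set1U (v : T) (A : {set T}) :
    v \notin A -> {in A &, forall u w, e v u -> e v w -> u = w} ->
  balanced_on e lab A -> balanced_on e lab (v |: A).
Proof.
move=> vA v1 [s sA].
pose b := if [pick u in A | e v u] is Some u then s u (+) lab v u else true.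
have bP u : u \in A -> e v u -> b (+) s u = lab v u.
  rewrite /b => uA evu; case: pickP => [w /andP[wA evw]|/(_ u)].
    by rewrite (v1 w u) // addbC addKb.
  by rewrite /= uA evu.
exists (fun u => if u == v then b else s u) => u w.
rewrite !in_setU1; have [->|uv] := eqVneq u v; have [->|wv] := eqVneq w v => /=.
- by rewrite e_irr.
- by move=> _ wA /bP; apply.
- by move=> uA _; rewrite e_sym lab_sym addbC => /bP; apply.
- exact: sA.
Qed.

(** The rank [h] certifies a forest: a vertex of maximal rank in any set has at most one neighbor
    there, so it can be added last. *)
Lemma balanced_of_rank (h : T -> int) :
    (forall u v, e u v -> h u != h v) ->
    (forall u v w, e u v -> e u w ->
       (h v < h u)%R -> (h w < h u)%R -> v = w) ->
  balanced_on e lab setT.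
Proof.
move=> h_neq h_inj; move: setT => A.
have [n] := ubnP #|A|; elim: n A => // n IHn A; rewrite ltnS => An.
have [->|[x0 x0A]] := set_0Vmem A; first exact: balanced_on_set0.
have [v v_A v_max] := Order.TotalTheory.arg_maxP h x0A.
have vA : v \in A by exact: v_A.
rewrite -(setD1K vA); apply: balanced_on_set1U; first by rewrite !inE eqxx.
  move=> u w; rewrite !inE => /andP[_ uA] /andP[_ wA] evu evw.
  apply: (h_inj v) => //; rewrite lt_neqAle eq_sym h_neq //=; exact: v_max.
by apply: IHn; rewrite (cardsD1 v) vA in An.
Qed.

(** A subtree [S] grows from a root; two neighbors of the new vertex in [S] would close a cycle with
    a simple path inside [S]. *)
Lemma balanced_of_tree :
    (forall u v, connect e u v) ->
    (forall s, 3 <= size s -> ~~ ucycleb e s) ->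
  balanced_on e lab setT.
Proof.
move=> e_conn e_acyclic.
have [->|[r _]] := set_0Vmem [set: T]; first exact: balanced_on_set0.
pose eS (S : {set T}) := [rel x y | [&& x \in S, y \in S & e x y]].
have eS_sym S : symmetric (eS S) by move=> x y /=; rewrite e_sym andbCA.
suff grow k : k < #|T| -> exists S : {set T}, [/\ #|S| = k.+1, r \in S,
    {in S, forall x, connect (eS S) r x} & balanced_on e lab S].
  have T_gt0 : 0 < #|T| by apply/card_gt0P; exists r.
  have [] := grow #|T|.-1; first by rewrite prednK.
  move=> S []; rewrite prednK // => cardS _ _.
  suff -> : S = setT by [].
  by apply/eqP; rewrite eqEcard subsetT cardsT cardS leqnn.
elim: k => [_|k IHk kT].
  exists [set r]; split; rewrite ?cards1 ?set11 //.
    by move=> x /set1P ->; rewrite connect0.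
  rewrite -(setU0 [set r]); apply: balanced_on_set1U; rewrite ?inE //.
    by move=> u; rewrite inE.
  exact: balanced_on_set0.
have [S [cardS rS S_conn S_bal]] := IHk (ltnW kT).
have [v v_S [u uS euv]] : exists2 v, v \notin S & exists2 u, u \in S & e u v.
  case: (boolP [exists v, (v \notin S) && [exists u in S, e u v]]).
    by case/existsP => v /andP[? /exists_inP[u ? ?]]; exists v => //; exists u.
  rewrite negb_exists => /forallP S_closed.
  have cl x y : e x y -> x \in S -> y \in S.
    move=> exy xS; apply: contraLR (S_closed y) => yS.
    by rewrite negbK yS; apply/exists_inP; exists x.
  have clS : closed e (mem S).
    by move=> x y exy; apply/idP/idP; apply: cl; rewrite // e_sym.
  have : S = setT.
    by apply/setP=> x; rewrite inE -(closed_connect clS (e_conn r x)).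
  by move=> ST; move: kT; rewrite -cardS ST cardsT ltnn.
exists (v |: S); split.
- by rewrite cardsU1 v_S cardS.
- by rewrite in_setU1 rS orbT.
- have S_conn' x : x \in S -> connect (eS (v |: S)) r x.
    move=> /S_conn; apply: connect_sub => y z /and3P[yS zS eyz].
    by apply: connect1; rewrite /= !inE yS zS eyz !orbT.
  move=> x /setU1P[->|]; last exact: S_conn'.
  apply: connect_trans (S_conn' u uS) (connect1 _).
  by rewrite /= !inE eqxx uS euv orbT.
apply: balanced_on_set1U => // x w xS wS evx evw.
apply: contraTeq isT => x_w.
have /connectP[p p_path w_last] : connect (eS S) x w.
  apply: connect_trans (S_conn w wS).
  by rewrite (sym_connect_sym (eS_sym S)); apply: S_conn.
case/shortenP: p_path w_last => q q_path q_uniq _ w_last.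
have qS : {subset q <= S}.
  elim: q (x) q_path {q_uniq w_last} => //= y q IHq z /andP[/and3P[_ yS _] q_path].
  by move=> a /predU1P[->|/IHq]; [|apply; exact: q_path].
have q_cycle : path e x (rcons q v).
  rewrite rcons_path -w_last e_sym evw andbT.
  by apply: sub_path q_path => a b /and3P[].
have vq : v \notin x :: q.
  rewrite inE negb_or (contra (qS v)) // andbT.
  by apply: contraNneq v_S => ->.
have := e_acyclic [:: v, x & q].
rewrite /ucycleb (cons_uniq v) vq q_uniq /= evx q_cycle /=.
(* An empty [q] would give [x = w]; otherwise [v], [x], [q] form a cycle of at least three
   vertices. *)
case: q w_last {q_path q_uniq qS q_cycle vq} => [xw|y q _ /(_ isT)//].
by rewrite /= xw eqxx in x_w.
Qed.

End Balance.

(** * Coloring around centers *)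

Lemma near_natE (a b t : nat) :
  (`|a%:Z - b%:Z| <= t%:Z)%R = (a <= b + t) && (b <= a + t).
Proof. lia. Qed.

Lemma colorable_of_centers (G : sgraph) (C : pred G) :
    (forall u v, C u -> C v -> ~~ adj u v) ->
    (forall u v w, C v -> C w -> adj u v -> adj u w -> v = w) ->
    (forall lab : rel G, symmetric lab ->
       balanced_on [rel u v | [&& ~~ C u, ~~ C v & adj u v]] lab setT) ->
  total_threshold_colorable G.
Proof.
move=> C_indep C_uniq C_bal N _.
have [|s sP] := C_bal [rel u v | [set u; v] \notin N].
  by move=> u v /=; rewrite setUC.
(* [far] picks the magnitude; a vertex with no adjacent center gets magnitude 1. *)
pose far v := [exists w, [&& C w, adj v w & [set v; w] \notin N]].
exists 5, 1; split=> //.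
exists (fun v => if C v then 3
                 else if far v then if s v then 5 else 1
                 else if s v then 4 else 2).
split=> [v|]; first by case: (C v); case: (far v); case: (s v).
have farE u v : C v -> adj u v -> far u = ([set u; v] \notin N).
  move=> Cv uv; apply/existsP/idP => [[w /and3P[Cw uw]]|uvN].
    by rewrite (C_uniq u v w).
  by exists v; rewrite Cv uv.
move=> u v uv; rewrite near_natE.
have [Cu|nCu] := boolP (C u); have [Cv|nCv] := boolP (C v).
- by have := C_indep u v Cu Cv; rewrite uv.
- by rewrite (farE v u) // 1?adj_sym // setUC; case: (_ \in N); case: (s v).
- by rewrite (farE u v) //; case: (_ \in N); case: (s u).
(* The colors 4 and 5 are within 1 of each other, as are 1 and 2, and these two groups are at least
   2 apart. *)
- have := sP u v (in_setT u) (in_setT v); rewrite /= nCu nCv uv => /(_ isT).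
  move=> suv; rewrite -[LHS]negbK -suv.
  by case: (far u); case: (far v); case: (s u); case: (s v).
Qed.

(** [C] and [h] are pulled back along [f], so one choice on an infinite grid serves all its finite
    subgraphs. *)
Lemma colorable_of_embedding (T : eqType) (e : rel T) (C : pred T)
    (h : T -> int) (G : sgraph) (f : G -> T) :
    (forall x y, C x -> C y -> ~~ e x y) ->
    (forall x y z, C y -> C z -> e x y -> e x z -> y = z) ->
    (forall x y, ~~ C x -> ~~ C y -> e x y -> h x != h y) ->
    (forall x y z, ~~ C x -> ~~ C y -> ~~ C z -> e x y -> e x z ->
       (h y < h x)%R -> (h z < h x)%R -> y = z) ->
    injective f -> (forall u v, adj u v -> e (f u) (f v)) ->
  total_threshold_colorable G.
Proof.
move=> C_indep C_uniq h_neq h_inj f_inj f_adj.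
apply: (@colorable_of_centers G [pred v | C (f v)]) => /=.
- by move=> u v Cu Cv; apply: contra (C_indep _ _ Cu Cv) => /f_adj.
- by move=> u v w Cv Cw /f_adj uv /f_adj uw; apply/f_inj/(C_uniq (f u)).
move=> lab lab_sym; apply: (@balanced_of_rank _ _ _ _ _ lab_sym (h \o f)) => /=.
- by move=> u v /=; rewrite adj_sym andbCA.
- by move=> u /=; rewrite adj_irr !andbF.
- by move=> u v /and3P[nCu nCv /f_adj]; apply: h_neq.
- move=> u v w /and3P[nCu nCv /f_adj uv] /and3P[_ nCw /f_adj uw] hv hw.
  by apply/f_inj/(h_inj (f u)).
Qed.

Lemma colorable_of_iso (H : sgraph) (C : pred H) (h : H -> int) (G : sgraph) :
    (forall x y, C x -> C y -> ~~ adj x y) ->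
    (forall x y z, C y -> C z -> adj x y -> adj x z -> y = z) ->
    (forall x y, ~~ C x -> ~~ C y -> adj x y -> h x != h y) ->
    (forall x y z, ~~ C x -> ~~ C y -> ~~ C z -> adj x y -> adj x z ->
       (h y < h x)%R -> (h z < h x)%R -> y = z) ->
  graph_iso G H -> total_threshold_colorable G.
Proof.
move=> C_indep C_uniq h_neq h_inj [f [f_bij f_adj]].
apply: (colorable_of_embedding C_indep C_uniq h_neq h_inj (bij_inj f_bij)).
by move=> u v; rewrite f_adj.
Qed.

(** * Paths, cycles, fans and trees *)

Lemma colorable_path (G : sgraph) : is_path G -> total_threshold_colorable G.
Proof.
case=> n _; apply: (colorable_of_iso (H := path_graph n)
  (C := pred0) (h := fun i : 'I_n => Posz i)).
- by [].
- by [].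
- by move=> i j _ _ /=; rewrite /path_rel /=; lia.
- by move=> i j k _ _ _ /=; rewrite /path_rel /= => ? ? ? ?; apply: ord_inj; lia.
Qed.

Lemma colorable_cycle (G : sgraph) : is_cycle G -> total_threshold_colorable G.
Proof.
case=> n _.
(* The successor wraps around only into 0, the center, so the other vertices form a path. *)
have succE (i j : 'I_n) : i.+1 %% n == j -> j != 0 :> nat -> i.+1 = j.
  move=> /eqP <-; case: (ltngtP i.+1 n) => [lt_in|lt_ni|->].
  - by rewrite modn_small.
  - by have := ltn_ord i; lia.
  - by rewrite modnn.
have adjE (i j : 'I_n) : adj (s := cycle_graph n) i j -> i != 0 :> nat ->
    j != 0 :> nat -> (i.+1 == j :> nat) || (j.+1 == i :> nat).
  by move=> /andP[_ /orP[] /succE ij] i0 j0; rewrite ij ?eqxx ?orbT.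
apply: (colorable_of_iso (H := cycle_graph n)
  (C := fun i : 'I_n => i == 0 :> nat) (h := fun i : 'I_n => Posz i)).
- move=> i j /eqP i0 /eqP j0; have -> : i = j by apply: ord_inj; rewrite i0 j0.
  by rewrite adj_irr.
- by move=> i j k /eqP j0 /eqP k0 _ _; apply: ord_inj; rewrite j0 k0.
- by move=> i j i0 j0 /adjE /(_ i0 j0); lia.
- move=> i j k i0 j0 k0 /adjE /(_ i0 j0) + /adjE /(_ i0 k0) ? ?.
  by move=> ? ?; apply: ord_inj; lia.
Qed.

Lemma colorable_fan (G : sgraph) : is_fan G -> total_threshold_colorable G.
Proof.
case=> n _; apply: (colorable_of_iso (H := cone (path_graph n))
  (* Coerced to [bool], an option is true on [Some], so [C] holds of the apex [None] alone. *)
  (C := fun x => ~~ x)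
  (h := fun x => if x is Some i then Posz (i : 'I_n) else 0%R)).
- by case=> [i|] [j|].
- by move=> x [j|] [k|].
- by case=> [i|] [j|] // _ _; rewrite /= /path_rel /=; lia.
- case=> [i|] [j|] [k|] //= _ _ _; rewrite /path_rel /= => ? ? ? ?.
  by congr Some; apply: ord_inj; lia.
Qed.

Lemma colorable_tree (G : sgraph) : is_tree G -> total_threshold_colorable G.
Proof.
case=> _ G_conn G_acyclic.
apply: (@colorable_of_centers G pred0) => // lab lab_sym.
exact: (balanced_of_tree (@adj_sym G) (@adj_irr G) lab_sym G_conn G_acyclic).
Qed.

(** * The two colorable grids *)

Lemma lattice_adjE k E (i j : 'I_k) (x y x' y' : int) :
  lattice_adj E (i, (x, y)) (j, (x', y')) =
    has (fun e => [&& i == e.1.1 :> nat, j == e.1.2 :> nat,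
                      x' == x + e.2.1 & y' == y + e.2.2]%R) E ||
    has (fun e => [&& j == e.1.1 :> nat, i == e.1.2 :> nat,
                      x == x' + e.2.1 & y == y' + e.2.2]%R) E.
Proof.
rewrite /lattice_adj -!has_pred1.
congr (_ || _); apply: eq_has => -[[a b] [c d]];
  rewrite /= -!pair_eqE /pair_eq /= -!pair_eqE /pair_eq /=; lia.
Qed.

(** The functions [center] and [prev] name the only possible center and lower neighbor, so
    uniqueness is checked one edge at a time instead of on pairs of edges. *)
Lemma colorable_of_lattice k E (C : pred (lattice_vertex k))
    (h : lattice_vertex k -> int)
    (center prev : lattice_vertex k -> nat * (int * int)) (G : sgraph) :
    (forall p q, C p -> C q -> ~~ lattice_adj E p q) ->
    (forall p q, C q -> lattice_adj E p q -> (q.1 : nat, q.2) = center p) ->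
    (forall p q, ~~ C p -> ~~ C q -> lattice_adj E p q ->
       h p != h q /\ ((h q < h p)%R -> (q.1 : nat, q.2) = prev p)) ->
  subgraph_of (lattice_adj (k := k) E) G -> total_threshold_colorable G.
Proof.
have vertex_inj (p q : lattice_vertex k) (r : nat * (int * int)) :
    (p.1 : nat, p.2) = r -> (q.1 : nat, q.2) = r -> p = q.
  by case: p q => [i x] [j y] <- [/ord_inj -> ->].
move=> C_indep C_center h_prev [f [f_inj f_adj]].
apply: (colorable_of_embedding (e := lattice_adj (k := k) E) (C := C) (h := h)
          _ _ _ _ f_inj f_adj) => //.
- move=> p q r Cq Cr /(C_center _ _ Cq) qE /(C_center _ _ Cr).
  exact: vertex_inj qE.
- by move=> p q nCp nCq /(h_prev _ _ nCp nCq)[].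
- move=> p q r nCp nCq nCr /(h_prev _ _ nCp nCq)[_ +] /(h_prev _ _ nCp nCr)[_ +].
  by move=> qE rE /qE{}qE /rE{}rE; apply: vertex_inj qE rE.
Qed.

Ltac lattice_edge_cases :=
  repeat case/orP; move=> // /and4P[/eqP ? /eqP ? /eqP ? /eqP ?].

(** The remaining paths climb through [p_3], [p_2], [p_1] of a cell to [p_3] of the cell above, and
    [h] grows by 1 at each step. Only [p_2] has its center in another square. *)
Lemma colorable_octagonal_square (G : sgraph) :
  subgraph_of octagonal_square_lattice G -> total_threshold_colorable G.
Proof.
apply: (@colorable_of_lattice _ _
  (fun p => p.1 == 0 :> nat)
  (fun p => 3 * p.2.2 - Posz p.1)%R
  (fun '(i, (x, y)) => (0%N, (x - Posz (i == 2 :> nat), y))%R)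
  (fun '(i, (x, y)) => if i == 3 :> nat then (1%N, (x, y - 1))%R
     else (i.+1, (x, y)))).
- move=> [i [x y]] [j [x' y']] /= ? ?; apply/negP; rewrite lattice_adjE /=.
  by lattice_edge_cases; lia.
- move=> [i [x y]] [j [x' y']] /= ?; rewrite lattice_adjE /=.
  by lattice_edge_cases; congr (_, (_, _)); lia.
- move=> [i [x y]] [j [x' y']] /= ? ?; rewrite lattice_adjE /=.
  by lattice_edge_cases; (split=> [|?]; first lia); case: ifP => ?;
    congr (_, (_, _)); lia.
Qed.

Lemma colorable_hexagonal (G : sgraph) :
  subgraph_of hexagonal_lattice G -> total_threshold_colorable G.
Proof.
(* The centers are p_0 with m = 0 and p_1 with m = 1; deleting them leaves
   disjoint infinite vertical paths, with [prev] going up along each path. *)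
pose m (x y : int) : int := modz (x + 2 * y)%R 4.
apply: (@colorable_of_lattice _ _
  (fun '(i, (x, y)) => m x y == Posz i)
  (* A path repeats after six vertices with [y] shifted by 2; the corrections to [- 3 * y] make [h]
     drop by 1 at each step of [prev]. *)
  (fun '(i, (x, y)) => if i == 0 :> nat
     then (- 3 * y + Posz (m x y == 2) - Posz (m x y == 3))%R
     else (- 3 * y - Posz (m x y == 0) - 2 * Posz (m x y == 3))%R)
  (* Along the three edges at [p_0] the value of [m] changes by 0, -1, -2, and at [p_1] by 0, 1, 2,
     modulo 4; so a noncentral vertex is adjacent to exactly one center. *)
  (fun '(i, (x, y)) => if i == 0 :> nat
     then (1%N, (x - Posz (m x y == 2), y - Posz (m x y == 3)))%R
     else (0%N, (x + Posz (m x y == 3), y + Posz (m x y == 2)))%R)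
  (fun '(i, (x, y)) => if i == 0 :> nat
     then (1%N, (x - Posz (m x y == 1), y))%R
     else (0%N, (x + Posz (m x y == 2), y + Posz (m x y != 2)))%R));
  rewrite /m => {m}.
- move=> [i [x y]] [j [x' y']] /= ? ?; apply/negP; rewrite lattice_adjE /=.
  by lattice_edge_cases; lia.
- move=> [i [x y]] [j [x' y']] /= ?; rewrite lattice_adjE /=.
  by lattice_edge_cases; case: ifP => ?; congr (_, (_, _)); lia.
- move=> [i [x y]] [j [x' y']] /= ? ?; rewrite lattice_adjE /=.
  by lattice_edge_cases; case: ifP => ?; case: ifP => ?; split=> [|?]; try lia;
    congr (_, (_, _)); lia.
Qed.

(** * Infeasible patches *)

Definition is_near (c : nat -> nat) (t : nat) (p : nat * nat) : bool :=
  (c p.1 <= c p.2 + t) && (c p.2 <= c p.1 + t).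

Lemma set2_inj (T : finType) (a b c d : T) :
  [set a; b] = [set c; d] -> (a = c /\ b = d) \/ (a = d /\ b = c).
Proof.
move=> eq_abcd.
have /set2P ab : a \in [set c; d] by rewrite -eq_abcd set21.
have /set2P bb : b \in [set c; d] by rewrite -eq_abcd set22.
have /set2P cb : c \in [set a; b] by rewrite eq_abcd set21.
have /set2P db : d \in [set a; b] by rewrite eq_abcd set22.
by case: ab bb cb db => ? [] ? [] ? [] ?; subst; auto.
Qed.

(* The pairs in [near] and [far] index vertices in [s]; the edges of the patch
   listed in neither are near. *)
Lemma noncolorable_patch k (E : seq (nat * nat * (int * int)))
    (s : seq (lattice_vertex k)) (x0 : lattice_vertex k)
    (near far : seq (nat * nat)) :
    all (fun e => (e.1.1 != e.1.2) || (e.2 != (0%R, 0%R))) E ->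
    uniq s ->
    all (fun p => [&& p.1 < size s, p.2 < size s &
                      lattice_adj E (nth x0 s p.1) (nth x0 s p.2)])
        (near ++ far) ->
    all (fun p => (p \notin far) && ((p.2, p.1) \notin far)) near ->
    (forall c t, all (is_near c t) near -> ~~ has (is_near c t) far -> False) ->
  exists G : sgraph, induced_subgraph_of (lattice_adj (k := k) E) G /\
    ~ total_threshold_colorable G.
Proof.
move=> E_irr s_uniq s_adj near_far infeasible.
pose e := [rel i j : 'I_(size s) | lattice_adj E (nth x0 s i) (nth x0 s j)].
have e_sym : symmetric e by move=> i j; rewrite /= /lattice_adj orbC.
have e_irr : irreflexive e.
  move=> i; rewrite /= /lattice_adj orbb subrr; apply/negP => /(allP E_irr).
  by rewrite /= !eqxx.
exists (SGraph e_sym e_irr); split.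
  exists (fun i : 'I_(size s) => nth x0 s i); split=> // i j /eqP.
  by rewrite nth_uniq // => /eqP /ord_inj.
pose is_far (i j : 'I_(size s)) :=
  ((i : nat, j : nat) \in far) || ((j : nat, i : nat) \in far).
pose N := [set A |
  [exists i, exists j, [&& e i j, ~~ is_far i j & A == [set i; j]]]].
have NE (i j : 'I_(size s)) : e i j -> ([set i; j] \in N) = ~~ is_far i j.
  move=> eij; rewrite inE; apply/existsP/idP => [[i']|nfar].
    case/existsP=> j' /and3P[_ far'].
    by move=> /eqP/set2_inj[[-> ->]|[-> ->]] //; rewrite /is_far orbC.
  by exists i; apply/existsP; exists j; rewrite eij nfar eqxx.
move=> /(_ N) [].
  apply/subsetP=> A; rewrite !inE => /existsP[i /existsP[j /and3P[eij _ Aij]]].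
  by apply/existsP; exists i; apply/existsP; exists j; apply/andP.
move=> r [t [_ [c [_ c_near]]]].
(* The default 0 only serves indices outside the patch; a coloring on [nat] makes the hypothesis
   [infeasible] pure arithmetic. *)
pose c' i := if insub i is Some j then c j else 0.
have is_nearE (p : nat * nat) : p \in near ++ far ->
    is_near c' t p = ~~ ((p \in far) || ((p.2, p.1) \in far)).
  move=> /(allP s_adj) /and3P[p1 p2 p_adj].
  rewrite /is_near /c' (insubT (fun i => i < size s) p1).
  rewrite (insubT (fun i => i < size s) p2) -near_natE -c_near //.
  by rewrite NE // /is_far; rewrite /= -surjective_pairing.
apply: (infeasible c' t).
  apply/allP=> p p_near; rewrite is_nearE ?mem_cat ?p_near // negb_or.
  exact: (allP near_far).
by apply/hasPn=> p p_far; rewrite is_nearE ?mem_cat ?p_far // orbT.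
Qed.

(** Each far pair is split by which endpoint has the larger color; branches are pruned as soon as
    [lia] refutes them. *)
Ltac infeasible :=
  move=> c t; rewrite /is_near /= !negb_or !negb_and -!ltnNge;
  do ![case/andP]; rewrite ?orbF;
  repeat match goal with
  | |- is_true (_ || _) -> _ => case/orP
  | |- is_true (_ && _) -> _ => case/andP
  | |- is_true _ -> _ => let H := fresh in move=> H; try (exfalso; lia)
  end.

(** The patch is the hub 0 with its hexagon 1, 3, 6, 2, 4, 5. If 1 and 3 lay on the same side of the
    color of 0, one of them would be more than [2t] away from it, but 5 and 6 bound this by [2t]. So
    they lie on opposite sides; the near path 1, 5, 4 puts 4 on the side of 1, the near path 3, 6, 2
    puts 2 on the side of 3, and the near edge 2-4 is violated. *)
Lemma triangular_noncolorable :
  exists G : sgraph, induced_subgraph_of triangular_lattice G /\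
    ~ total_threshold_colorable G.
Proof.
pose p0 x y : lattice_vertex 1 := (@Ordinal 1 0 isT, (x, y)).
apply: (@noncolorable_patch 1 _
  [:: p0 0 0; p0 1 0; p0 (- 1) 0; p0 0 1; p0 0 (- 1); p0 1 (- 1);
      p0 (- 1) 1]%R (p0 0 0)%R
  [:: (0, 5); (0, 6); (1, 5); (2, 4); (2, 6); (3, 6); (4, 5)]
  [:: (0, 1); (0, 2); (0, 3); (0, 4); (1, 3)]) => //.
infeasible.
Qed.

(** Vertices 0 and 1 are near 3 but far from each other, hence on opposite sides of the color of 3.
    Then 2 and 4 lie more than [t] away on these sides, 5 and 7 still lie strictly on them, and 6,
    near both, is within [t] of 3, against the far edge 3-6. *)
Lemma elongated_triangular_noncolorable :
  exists G : sgraph, induced_subgraph_of elongated_triangular_lattice G /\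
    ~ total_threshold_colorable G.
Proof.
pose p0 x y : lattice_vertex 2 := (@Ordinal 2 0 isT, (x, y)).
pose p1 x y : lattice_vertex 2 := (@Ordinal 2 1 isT, (x, y)).
apply: (@noncolorable_patch 2 _
  [:: p1 1 0; p1 2 0; p0 0 1; p0 1 1; p0 2 1; p1 0 1; p1 1 1; p1 2 1]%R
  (p0 0 0)%R
  [:: (0, 2); (0, 3); (1, 3); (1, 4); (2, 5); (4, 7); (5, 6); (6, 7)]
  [:: (0, 1); (2, 3); (3, 4); (3, 6)]) => //.
infeasible.
Qed.

(** Vertices 1 and 5 are near 0 and far from each other, hence on opposite sides of its color. The
    near walk 5, 4, 10, 3, 9, 2 forces 4, 3 and 2 onto the side of 5, so 6, near 2, is on that side
    too. As 6 and 8 are near 1 and far from each other, 8 lies beyond 1; then 7 is more than [t]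
    beyond 1, and 11, near 7, is beyond 1 as well, too far from 5. *)
Lemma snub_square_noncolorable :
  exists G : sgraph, induced_subgraph_of snub_square_lattice G /\
    ~ total_threshold_colorable G.
Proof.
pose p0 x y : lattice_vertex 4 := (@Ordinal 4 0 isT, (x, y)).
pose p1 x y : lattice_vertex 4 := (@Ordinal 4 1 isT, (x, y)).
pose p2 x y : lattice_vertex 4 := (@Ordinal 4 2 isT, (x, y)).
pose p3 x y : lattice_vertex 4 := (@Ordinal 4 3 isT, (x, y)).
apply: (@noncolorable_patch 4 _
  [:: p0 0 0; p1 0 0; p3 0 0; p1 (- 1) 0; p3 0 (- 1); p2 0 (- 1); p2 0 0;
      p0 1 0; p3 1 0; p2 (- 1) 0; p2 (- 1) (- 1); p3 1 (- 1)]%R (p0 0 0)%R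
  [:: (0, 1); (0, 5); (1, 6); (1, 8); (2, 6); (2, 9);
      (3, 9); (3, 10); (4, 5); (4, 10); (5, 11); (7, 8); (7, 11)]
  [:: (0, 2); (0, 3); (0, 4); (1, 5); (1, 7); (2, 3); (6, 8)]) => //.
infeasible.
Qed.

Theorem theorem2 :
  (forall G : sgraph,
     is_path G \/ is_cycle G \/ is_tree G \/ is_fan G \/
     subgraph_of hexagonal_lattice G \/
     subgraph_of octagonal_square_lattice G ->
     total_threshold_colorable G) /\
  (exists G : sgraph,
     induced_subgraph_of triangular_lattice G /\
     ~ total_threshold_colorable G) /\
  (exists G : sgraph,
     induced_subgraph_of elongated_triangular_lattice G /\
     ~ total_threshold_colorable G) /\
  (exists G : sgraph,
     induced_subgraph_of snub_square_lattice G /\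
     ~ total_threshold_colorable G).
Proof.
split; last split; last split.
- move=> G [|[|[|[|[|]]]]].
  + exact: colorable_path.
  + exact: colorable_cycle.
  + exact: colorable_tree.
  + exact: colorable_fan.
  + exact: colorable_hexagonal.
  + exact: colorable_octagonal_square.
- exact: triangular_noncolorable.
- exact: elongated_triangular_noncolorable.
- exact: snub_square_noncolorable.
Qed.
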